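(* Let $a,b\ge1$ be integers, $g=\gcd(a,b)$, and $j\in[1,g-1]$. Let $A=[0,1]\cup[j+1,g]$ and $I=(x^{i\frac ag}y^{b-i\frac bg} : i\in A)\subset K[x,y]$. Then $r(I)=j$.
   Context: $K$ is a field. With $J=(x^a,y^b)$, the reduction number $r(I)$ is the smallest integer $r\ge0$ with $I^{r+1}=JI^r$ (such $r$ exists for the ideals considered). $[c,d]$ denotes the set of integers $i$ with $c\le i\le d$. *)

(* Defs.v *)
From mathcomp Require Import all_boot all_order all_algebra.
From mathcomp Require Import mpoly.

Set Implicit Arguments.
Unset Strict Implicit.
Unset Printing Implicit Defensive.

Import GRing.Theory.
Local Open Scope ring_scope.

Section Ideals.
Variable R : comNzRingType.
Implicit Types (G I J : R -> Prop) (n r : nat).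

Definition ideal_gen G : R -> Prop := fun f =>
  exists n (c h : 'I_n -> R),
    (forall k, G (h k)) /\ f = \sum_(k < n) c k * h k.

Definition ideal_mul I J : R -> Prop :=
  ideal_gen (fun f => exists u v, [/\ I u, J v & f = u * v]).

Fixpoint ideal_exp I n : R -> Prop :=
  if n is m.+1 then ideal_mul I (ideal_exp I m) else fun=> True.

Definition ideal_eq I J : Prop := forall f, I f <-> J f.

Definition reduction_eq J I r : Prop :=
  ideal_eq (ideal_exp I r.+1) (ideal_mul J (ideal_exp I r)).

(* A relation rather than a function: [is_reduction_number J I r] also asserts
   that some exponent satisfies [reduction_eq J I]. *)
Definition is_reduction_number J I r : Prop :=
  reduction_eq J I r /\ forall s, reduction_eq J I s -> (r <= s)%N.

End Ideals.

Section TwoVariables.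
Variable K : fieldType.

Definition varx : {mpoly K[2]} := 'X_(ord0 : 'I_2).
Definition vary : {mpoly K[2]} := 'X_(ord_max : 'I_2).

Definition param_ideal (a b : nat) : {mpoly K[2]} -> Prop :=
  ideal_gen (fun f => f = varx ^+ a \/ f = vary ^+ b).

(* Meant for A contained in [0, gcd(a, b)], where the truncated subtraction
   is exact; the divisions by the gcd always are. *)
Definition segment_ideal (a b : nat) (A : pred nat) : {mpoly K[2]} -> Prop :=
  let g := gcdn a b in
  ideal_gen (fun f => exists2 i : nat, A i &
    f = varx ^+ (i * (a %/ g)) * vary ^+ (b - i * (b %/ g))).

End TwoVariables.

Arguments param_ideal K a b : clear implicits.
Arguments segment_ideal K a b A : clear implicits.

(* Main.v *)
Require Import Defs.
From mathcomp Require Import all_boot all_order all_algebra.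
From mathcomp Require Import mpoly zify.

Set Implicit Arguments.
Unset Strict Implicit.
Unset Printing Implicit Defensive.

Import GRing.Theory.

(** Write [g = gcdn a b], [p = a / g], [q = b / g].  All the monomials involved
    lie on a diagonal: a product of [n] generators of [I] is
    [x ^ (s p) * y ^ ((n g - s) q)], where [s] is a sum of [n] elements of [A].
    For fixed [n] no such monomial divides another one, so a monomial ideal
    generated by some of them remembers exactly which [s] occur.  The equation
    [I ^ (r+1) = J I ^ r] therefore becomes an equation between sets of integers,
    [A + rA = {0, g} + rA] ([reduction_eq_segment]), with [rA] the [r]-fold sumset.

    Choosing how many of the [n] summands come from the long segment [[j+1, g]]
    shows that [nA] is the union over [k <= n] of the intervals
    [[k (j+1), k g + (n - k)]] ([nfold_sum_segments]).

    For [r < j] the integer [r + 1 = 1 + ... + 1] lies in [(r+1)A].  It is not in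
    [{0, g} + rA]: it is smaller than [g], too large for the interval [k = 0] of
    [rA], and too small for the intervals with [k >= 1], which start at [j + 1]
    or later.  For [r = j], if [g >= j + 2] the intervals composing [jA] leave
    no gap, so [jA = [0, j g]] and [{0, g} + jA = [0, (j+1) g]] is everything;
    if [g = j + 1] the intervals start at multiples of [g], and an element of
    [(j+1)A] that is outside [jA] is the last point of an interval and is
    brought back to [jA] by subtracting [g]. *)

(** * Monomial ideals and sumsets of exponents *)

Definition sumset (T : Type) (op : T -> T -> T) (A B : T -> Prop) : T -> Prop :=
  fun z => exists x y, [/\ A x, B y & z = op x y].

Section MonomialIdeals.
Local Open Scope ring_scope.
Variables (R : comNzRingType) (n : nat).
Implicit Types (S T : 'X_{1..n} -> Prop) (I J : {mpoly R[n]} -> Prop).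

(** The ideal generated by the monomials with exponent in [S], described by
    supports: this form makes membership a condition on each monomial separately,
    and [ideal_gen_monomial] identifies it with the generated ideal. *)
Definition monomial_ideal S : {mpoly R[n]} -> Prop :=
  fun f => forall m, m \in msupp f -> exists2 s, S s & (s <= m)%MM.

Lemma monomial_ideal_sum S (X : Type) (r : seq X) (F : X -> {mpoly R[n]}) :
  (forall x, monomial_ideal S (F x)) -> monomial_ideal S (\sum_(x <- r) F x).
Proof.
move=> SF; elim/big_rec: _ => [|x f _ Sf] m; first by rewrite msupp0.
by move/msuppD_le; rewrite mem_cat => /orP[/SF|/Sf].
Qed.

Lemma monomial_idealM S T f h :
  monomial_ideal S f -> monomial_ideal T h ->
  monomial_ideal (sumset +%MM S T) (f * h).
Proof.
move=> Sf Th m /msuppM_le/allpairsP[[u v] /= [/Sf[s Ss su] /Th[t Tt tv] ->]].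
exists (s + t)%MM; first by exists s, t.
by apply/mnm_lepP => i; rewrite !mnmDE leq_add // (mnm_lepP _).
Qed.

Lemma monomial_ideal_mull S c f :
  monomial_ideal S f -> monomial_ideal S (c * f).
Proof.
move=> Sf m /msuppM_le/allpairsP[[u v] /= [_ /Sf[s Ss sv] ->]].
exists s => //; exact: (lepm_trans sv (lem_addl _ _)).
Qed.

Lemma monomial_idealX S m :
  monomial_ideal S 'X_[m] <-> exists2 s, S s & (s <= m)%MM.
Proof.
split=> [|ex_s k]; first by apply; rewrite msuppX mem_seq1.
by rewrite msuppX mem_seq1 => /eqP->.
Qed.

Lemma eq_monomial_ideal S T :
  (forall m, S m <-> T m) -> ideal_eq (monomial_ideal S) (monomial_ideal T).
Proof.
by move=> ST f; split=> Hf m /Hf[s /ST Hs sm]; exists s.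
Qed.

(** The two hypotheses squeeze [G] between the monomials of [S] and the ideal
    they generate.  This leaves room for the generators of a product of ideals,
    which are products of arbitrary polynomials. *)
Lemma ideal_gen_monomial S (G : {mpoly R[n]} -> Prop) :
  (forall f, G f -> monomial_ideal S f) -> (forall s, S s -> G 'X_[s]) ->
  ideal_eq (ideal_gen G) (monomial_ideal S).
Proof.
move=> GS SG f; split=> [[k [c [h [Gh ->]]]]|Sf].
  by apply: monomial_ideal_sum => i; apply/monomial_ideal_mull/GS.
have /fin_all_exists [s Hs] i :
    exists s, S s /\ (s <= tnth (in_tuple (msupp f)) i)%MM.
  by have [s Ss le_s] := Sf _ (mem_tnth i (in_tuple (msupp f))); exists s.
pose m i := tnth (in_tuple (msupp f)) i.
(* Each term of [f] is a multiple of a chosen monomial of [S]. *)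
exists (size (msupp f)), (fun i => f@_(m i) *: 'X_[m i - s i]),
  (fun i => 'X_[s i]); split=> [i|]; first exact: SG (Hs i).1.
rewrite {1}(mpolyE f) big_tnth; apply: eq_bigr => i _.
by rewrite -scalerAl -mpolyXD submK ?(Hs i).2.
Qed.

Lemma ideal_mul_monomial S T I J :
  ideal_eq I (monomial_ideal S) -> ideal_eq J (monomial_ideal T) ->
  ideal_eq (ideal_mul I J) (monomial_ideal (sumset +%MM S T)).
Proof.
move=> IS JT; apply: ideal_gen_monomial => [f [u [v [/IS Su /JT Tv ->]]]|].
  exact: monomial_idealM.
move=> _ [s [t [Ss Tt ->]]]; exists 'X_[s], 'X_[t].
split; last exact: mpolyXD.
  by apply/IS/monomial_idealX; exists s => //; apply: lepm_refl.
by apply/JT/monomial_idealX; exists t => //; apply: lepm_refl.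
Qed.

End MonomialIdeals.
Arguments monomial_ideal R {n} S.

(** * Monomials on a diagonal *)

Section DiagonalMonomials.
Variables p q : nat.

Definition diag_monomial (N s : nat) : 'X_{1..2} :=
  (U_(ord0) *+ (s * p) + U_(ord_max) *+ ((N - s) * q))%MM.

Definition diag_set (N : nat) (A : nat -> Prop) : 'X_{1..2} -> Prop :=
  fun m => exists2 s, A s & m = diag_monomial N s.

Lemma diag_monomialD M N s t : s <= M -> t <= N ->
  (diag_monomial M s + diag_monomial N t)%MM = diag_monomial (M + N) (s + t).
Proof.
move=> sM tN; apply/mnmP => i; rewrite !mnmDE !mulmnE.
have ->: M + N - (s + t) = M - s + (N - t) by lia.
by rewrite !mulnDl !mulnDr; lia.
Qed.

(** Along the diagonal one exponent grows while the other decreases, so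
    divisibility forces equality. *)
Lemma diag_monomial_le N s t : 0 < p -> 0 < q -> s <= N -> t <= N ->
  (diag_monomial N s <= diag_monomial N t)%MM -> s = t.
Proof.
move=> p0 q0 sN tN /mnm_lepP le_st.
have := le_st ord0; have := le_st ord_max.
rewrite !mnmDE !mulmnE !mnm1E /= !mul0n !mul1n !addn0 !add0n !leq_pmul2r //.
lia.
Qed.

Lemma sumset_diag M N (A B : nat -> Prop) m :
  (forall s, A s -> s <= M) -> (forall t, B t -> t <= N) ->
  sumset +%MM (diag_set M A) (diag_set N B) m <->
  diag_set (M + N) (sumset addn A B) m.
Proof.
move=> AM BN; split.
  move=> [_ [_ [[s As ->] [t Bt ->] ->]]].
  exists (s + t); first by exists s, t.
  by rewrite diag_monomialD ?AM ?BN.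
move=> [_ [s [t [As Bt ->]]] ->].
exists (diag_monomial M s), (diag_monomial N t); split.
- by exists s.
- by exists t.
- by rewrite diag_monomialD ?AM ?BN.
Qed.

(** Since the diagonal monomials form an antichain, each one that belongs to the
    ideal has to be one of the generators. *)
Lemma diag_ideal_inj (R : comNzRingType) N (A B : nat -> Prop) :
    0 < p -> 0 < q ->
    (forall s, A s -> s <= N) -> (forall s, B s -> s <= N) ->
  ideal_eq (monomial_ideal R (diag_set N A)) (monomial_ideal R (diag_set N B))
  <-> forall s, A s <-> B s.
Proof.
move=> p0 q0 AN BN.
have sub (C D : nat -> Prop) s :
    (forall s, C s -> s <= N) -> (forall s, D s -> s <= N) ->
    (forall f, monomial_ideal R (diag_set N C) f ->
               monomial_ideal R (diag_set N D) f) -> C s -> D s.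
  move=> CN DN CD Cs.
  have /monomial_idealX[_ [t Dt ->]] :
      monomial_ideal R (diag_set N D) 'X_[diag_monomial N s].
    apply/CD/monomial_idealX; exists (diag_monomial N s); last exact: lepm_refl.
    by exists s.
  by move/(diag_monomial_le p0 q0 (DN _ Dt) (CN _ Cs)) <-.
split=> [AB s|AB]; first by split; apply: sub => // f /AB.
by apply: eq_monomial_ideal => m; split=> -[s /AB Hs ->]; exists s.
Qed.

End DiagonalMonomials.

(** * Reduction equations as equations between sumsets *)

Fixpoint nfold_sum (A : nat -> Prop) (n : nat) : nat -> Prop :=
  if n is m.+1 then sumset addn A (nfold_sum A m) else fun s => s = 0.

Lemma nfold_sum_le (A : nat -> Prop) g n s :
  (forall i, A i -> i <= g) -> nfold_sum A n s -> s <= n * g.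
Proof.
move=> Ag; elim: n s => [_ ->//|n IHn _ [i [t [/Ag ig /IHn tn ->]]]].
by rewrite mulSn leq_add.
Qed.

Section ReductionCriterion.
Variables (K : fieldType) (a b : nat).
Hypotheses (a_gt0 : 0 < a) (b_gt0 : 0 < b).
Local Notation g := (gcdn a b).
Local Notation p := (a %/ g).
Local Notation q := (b %/ g).
Implicit Type A : pred nat.

Lemma varxy_diag i : i <= g ->
  (varx K ^+ (i * p) * vary K ^+ (b - i * q) = 'X_[diag_monomial p q g i])%R.
Proof.
move=> ig; rewrite /varx /vary !mpolyXn -mpolyXD /diag_monomial.
by rewrite mulnBl [g * q]mulnC divnK ?dvdn_gcdr.
Qed.

Lemma segment_ideal_diag A : (forall i, A i -> i <= g) ->
  ideal_eq (segment_ideal K a b A) (monomial_ideal K (diag_set p q g A)).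
Proof.
move=> Ag; apply: ideal_gen_monomial => [f [i Ai ->]|m [i Ai ->]].
  rewrite varxy_diag ?Ag //; apply/monomial_idealX.
  exists (diag_monomial p q g i); last exact: lepm_refl.
  by exists i.
by exists i => //; rewrite varxy_diag ?Ag.
Qed.

(** The parameters [y ^ b] and [x ^ a] are the two endpoints of the diagonal. *)
Lemma param_ideal_diag :
  ideal_eq (param_ideal K a b)
           (monomial_ideal K (diag_set p q g (fun i => i = 0 \/ i = g))).
Proof.
have Xa : (varx K ^+ a = 'X_[diag_monomial p q g g])%R.
  rewrite -varxy_diag // [g * p]mulnC [g * q]mulnC !divnK ?dvdn_gcdl ?dvdn_gcdr //.
  by rewrite subnn expr0 mulr1.
have Yb : (vary K ^+ b = 'X_[diag_monomial p q g 0])%R.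
  by rewrite -varxy_diag // !mul0n expr0 mul1r subn0.
apply: ideal_gen_monomial => [f|m [i [->|->] ->]]; last 2 first.
- by right; rewrite Yb.
- by left; rewrite Xa.
rewrite Xa Yb; case=> ->; apply/monomial_idealX; eexists; try exact: lepm_refl.
  by exists g; [right|].
by exists 0; [left|].
Qed.

Lemma segment_ideal_exp A n : (forall i, A i -> i <= g) ->
  ideal_eq (ideal_exp (segment_ideal K a b A) n)
           (monomial_ideal K (diag_set p q (n * g) (nfold_sum A n))).
Proof.
move=> Ag; elim: n => [|n IHn] f.
  split=> // _ m _; exists (diag_monomial p q 0 0); first by exists 0.
  by apply/mnm_lepP => i; rewrite mnmDE !mulmnE !muln0.
apply: iff_trans (ideal_mul_monomial (segment_ideal_diag Ag) IHn f) _.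
rewrite mulSn; apply: eq_monomial_ideal => m; apply: sumset_diag => // s.
exact: nfold_sum_le.
Qed.

(** Both sides of the reduction equation are generated by monomials on the same
    diagonal [r.+1 * g], where the ideal determines the generators. *)
Lemma reduction_eq_segment A r : (forall i, A i -> i <= g) ->
  reduction_eq (param_ideal K a b) (segment_ideal K a b A) r <->
  forall s, sumset addn A (nfold_sum A r) s <->
            sumset addn (fun i => i = 0 \/ i = g) (nfold_sum A r) s.
Proof.
move=> Ag.
have g_gt0 : 0 < g by rewrite gcdn_gt0 a_gt0.
have p_gt0 : 0 < p by rewrite divn_gt0 // dvdn_leq ?dvdn_gcdl.
have q_gt0 : 0 < q by rewrite divn_gt0 // dvdn_leq ?dvdn_gcdr.
have rA_le s : nfold_sum A r s -> s <= r * g by apply: nfold_sum_le.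
have J_le i : i = 0 \/ i = g -> i <= g by case=> ->.
have JI f : ideal_mul (param_ideal K a b)
      (ideal_exp (segment_ideal K a b A) r) f <->
    monomial_ideal K (diag_set p q (r.+1 * g)
      (sumset addn (fun i => i = 0 \/ i = g) (nfold_sum A r))) f.
  apply: iff_trans
    (ideal_mul_monomial param_ideal_diag (segment_ideal_exp r Ag) f) _.
  by rewrite mulSn; apply: eq_monomial_ideal => m; apply: sumset_diag.
have II := segment_ideal_exp r.+1 Ag.
have le_sum (B : nat -> Prop) : (forall i, B i -> i <= g) -> forall s,
    sumset addn B (nfold_sum A r) s -> s <= r.+1 * g.
  by move=> Bg _ [i [t [/Bg ig /rA_le tr ->]]]; rewrite mulSn leq_add.
apply: iff_trans
  (diag_ideal_inj K p_gt0 q_gt0 (le_sum _ Ag) (le_sum _ J_le)).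
split=> E f.
  exact: iff_trans (iff_sym (II f)) (iff_trans (E f) (JI f)).
exact: iff_trans (II f) (iff_trans (E f) (iff_sym (JI f))).
Qed.

End ReductionCriterion.

(** * Sumsets of two segments *)

Section SegmentSums.
Variables g j : nat.
Hypothesis hj : 1 <= j <= g - 1.
Let A : pred nat := fun i => (0 <= i <= 1) || (j + 1 <= i <= g).

(** [k] counts the summands taken in [[j+1, g]], the other [n - k] being [0] or
    [1].  Conversely an element of the [k]-th interval is decomposed by removing
    one summand that leaves an element of an interval of the [n]-fold sumset. *)
Lemma nfold_sum_segments n s :
  nfold_sum A n s <->
  exists k, [/\ k <= n, k * (j + 1) <= s & s <= k * g + (n - k)].
Proof.
elim: n s => [|n IHn] s /=.
  split=> [->|[k [k0 _]]]; first by exists 0.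
  have -> : k = 0 by lia.
  lia.
split=> [[i [t [Ai /IHn[k [kn lo hi]] ->]]]|[k [kn lo hi]]].
  have [i_le1|i_gt1] := leqP i 1; first by exists k; split; lia.
  by exists k.+1; rewrite /A in Ai; split; lia.
have kjg : k * (j + 1) <= k * g by rewrite leq_mul2l; lia.
suff [i [Ai i_le rest]] : exists i, [/\ A i, i <= s & exists k',
    [/\ k' <= n, k' * (j + 1) <= s - i & s - i <= k' * g + (n - k')]].
  by exists i, (s - i); split=> //; [apply/IHn | lia].
(* If some summand is small it is [0], or [1] at the very end of the interval;
   otherwise a long summand is removed, [g] or whatever exceeds [n * (j + 1)]. *)
have [k_le|k_gt] := leqP k n.
  have [s_le|s_gt] := leqP s (k * g + (n - k)).
    by exists 0; split=> //; exists k; split; lia.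
  by exists 1; split=> //; [lia | exists k; split; lia].
have ek : k = n.+1 by lia.
move: lo hi kjg; rewrite {}ek !mulSn subnn addn0 => lo hi kjg.
have [s_ge|s_lt] := leqP (g + n * (j + 1)) s.
  by exists g; split; [rewrite /A; lia | lia | exists n; split; lia].
exists (s - n * (j + 1)); split; [rewrite /A; lia | lia | exists n; split; try lia].
have : n * (j + 1) <= n * g by rewrite leq_mul2l; lia.
lia.
Qed.

(** The case [g = j + 1] is separate because only then can there be gaps between
    consecutive intervals of [jA]. *)
Lemma segments_sum_stable s :
  sumset addn A (nfold_sum A j) s <->
  sumset addn (fun i => i = 0 \/ i = g) (nfold_sum A j) s.
Proof.
split=> [|[i [t [Ji At ->]]]]; last first.
  by exists i, t; split=> //; case: Ji => ->; rewrite /A; lia.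
move/(nfold_sum_segments j.+1) => [k [kj lo hi]].
suff [At|[gs At]] : nfold_sum A j s \/ g <= s /\ nfold_sum A j (s - g).
- by exists 0, s; split=> //; left.
- by exists g, (s - g); split=> //; [right | lia].
have [g_eq|g_neq] := eqVneq g (j + 1).
  have [k_le|k_gt] := leqP k j.
    have [s_le|s_gt] := leqP s (k * g + (j - k)).
      by left; apply/nfold_sum_segments; exists k; split.
    (* [s] is the last point of the [k]-th interval of [(j+1)A]; subtracting [g]
       gives the last point of the previous interval of [jA]. *)
    case: k kj lo hi k_le s_gt => [|k] kj lo hi k_le s_gt.
      (* Here [s = j + 1 = g]. *)
      left; apply/nfold_sum_segments; exists 1; split; lia.
    right; split; first by nia.
    by apply/nfold_sum_segments; exists k; split; nia.
  have ek : k = j.+1 by lia.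
  right; split; first by nia.
  by apply/nfold_sum_segments; exists j; split; nia.
have jA t : t <= j * g -> nfold_sum A j t.
  move=> t_le; apply/nfold_sum_segments.
  have gj2 : j + 2 <= g by lia.
  have [t_lt|t_ge] := ltnP t (j * (j + 1)); last by exists j; split; lia.
  (* The quotient indexes the interval: it ends at [k' * g + (j - k')], which
     reaches [k' * (j + 1) + j] because [g] is at least [j + 2]. *)
  set k' := t %/ (j + 1).
  have t_eq : t = k' * (j + 1) + t %% (j + 1) := divn_eq t (j + 1).
  have rem_lt : t %% (j + 1) < j + 1 by rewrite ltn_mod addn1.
  have k'_lt : k' < j by rewrite /k' ltn_divLR ?addn_gt0 ?orbT.
  have k'g : k' * (j + 2) <= k' * g by rewrite leq_mul2l gj2 orbT.
  by exists k'; split; lia.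
have s_le : s <= j.+1 * g.
  have [k_le|k_gt] := leqP k j; nia.
have [/jA|s_gt] := leqP s (j * g); first by left.
right; split; first by nia.
by apply: jA; lia.
Qed.

(** The witness is [r.+1], the sum of [r.+1] ones. *)
Lemma segments_sum_unstable r :
  (forall s, sumset addn A (nfold_sum A r) s <->
             sumset addn (fun i => i = 0 \/ i = g) (nfold_sum A r) s) ->
  j <= r.
Proof.
move=> E; rewrite leqNgt; apply/negP => r_lt.
have : nfold_sum A r.+1 r.+1.
  by apply/nfold_sum_segments; exists 0; split; lia.
move/E => [i [t [Ji /nfold_sum_segments[k [kr lo hi]] e]]].
case: Ji => ei; last lia.
by case: k kr lo hi => [|k] kr lo hi; [lia | nia].
Qed.

End SegmentSums.

Theorem theorem3p1 (K : fieldType) (a b j : nat)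
  (ha : (1 <= a)%N) (hb : (1 <= b)%N)
  (hj : (1 <= j <= gcdn a b - 1)%N) :
  is_reduction_number (param_ideal K a b)
    (segment_ideal K a b
       (fun i : nat => (0 <= i <= 1)%N || (j + 1 <= i <= gcdn a b)%N))
    j.
Proof.
have A_le i : (0 <= i <= 1) || (j + 1 <= i <= gcdn a b) -> i <= gcdn a b by lia.
split=> [|s /(reduction_eq_segment K ha hb s A_le)].
  by apply/(reduction_eq_segment K ha hb j A_le)/segments_sum_stable.
exact: segments_sum_unstable.
Qed.
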